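(* Let $p\ge 5$ be a prime and let $\mathbb{H}=(\mathbb{Z}/p\mathbb{Z})/G$ be the quotient hyperfield with $G\subseteq(\mathbb{Z}/p\mathbb{Z})^\times$ a subgroup with $|G|=4$. Let $(a,b)$ be the solution in positive integers (unique up to order) to $a^2+b^2=p$, and let $n=a+b$. Then $\operatorname{gen}(\mathbb{H})=\{2,n\}$.
   Context: Let $p$ be a prime and $G$ a subgroup of $(\mathbb{Z}/p\mathbb{Z})^\times$. The hyperfield $\mathbb{H}=(\mathbb{Z}/p\mathbb{Z})/G$ has as elements the orbits $[a]=\{ga: g\in G\}$, $a\in\mathbb{Z}/p\mathbb{Z}$; multiplication is $[a]\odot[b]=[ab]$, and the multivalued hyperaddition is $[a]\boxplus[b]=\{[c] : [c]\subseteq\{x+y : x\in[a],\ y\in[b]\}\}$, extended to non-empty subsets $A,B$ of $\mathbb{H}$ by $A\boxplus B=\bigcup_{\alpha\in A,\beta\in B}(\alpha\boxplus\beta)$. The zero element is $0=[0]$. For a natural number $k$ and $x\in\mathbb{H}$, $kx$ denotes the set $x\boxplus x\boxplus\cdots\boxplus x$ with $k$ copies of $x$ (the empty sum being $\{0\}$). The characteristic $\operatorname{char}(\mathbb{H})$ is the additive submonoid (containing $0$) of all natural numbers $k$ such that $0\in kx$ for all $x\in\mathbb{H}$. The generating set $\operatorname{gen}(\mathbb{H})$ is the finite set $\{g_1,\dots,g_r\}$ of distinct natural numbers of minimal cardinality such that $\operatorname{char}(\mathbb{H})=\{g_1x_1+\cdots+g_rx_r : x_i\in\mathbb{Z}_{\ge0}\}$.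 *)

(* Defs.v *)
From mathcomp Require Import all_boot all_order all_algebra all_fingroup.
From mathcomp Require Import finmap.

Set Implicit Arguments.
Unset Strict Implicit.
Unset Printing Implicit Defensive.

Import GRing.Theory.
Local Open Scope ring_scope.

Section QuotientHyperfield.

Variable p : nat.

(* The library's 'F_p is Z/pZ whenever p is prime; {unit 'F_p} is its group of
   units, and 'U is the action of that group on 'F_p by multiplication. *)
Variable G : {group {unit 'F_p}}.

Definition hclass (a : 'F_p) : {set 'F_p} := orbit 'U%act G a.

Definition hyperfield : {set {set 'F_p}} := [set hclass a | a : 'F_p].

Definition hadd (x y : {set 'F_p}) : {set {set 'F_p}} :=
  [set z in hyperfield | z \subset [set s + t | s in x, t in y]].

Definition haddS (A B : {set {set 'F_p}}) : {set {set 'F_p}} :=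
  \bigcup_(x in A) \bigcup_(y in B) hadd x y.

(* The k-fold hypersum x + (x + (... + (x + 0))). *)
Definition hmuln (k : nat) (x : {set 'F_p}) : {set {set 'F_p}} :=
  iter k (haddS [set x]) [set hclass 0].

Definition hchar (k : nat) : Prop :=
  forall x, x \in hyperfield -> hclass 0 \in hmuln k x.

End QuotientHyperfield.

Definition generates (M : nat -> Prop) (S : {fset nat}) : Prop :=
  forall k : nat, M k <-> exists c : nat -> nat, k = (\sum_(g <- S) g * c g)%N.

Definition min_generates (M : nat -> Prop) (S : {fset nat}) : Prop :=
  generates M S /\ forall T : {fset nat}, generates M T -> (#|` S| <= #|` T|)%N.

(* "gen(H) = S" as a definite description: S is the one and only generating set
   of minimal cardinality of char(H). *)
Definition gen_is (p : nat) (G : {group {unit 'F_p}}) (S : {fset nat}) : Prop :=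
  forall T : {fset nat}, min_generates (hchar G) T <-> T = S.

Definition sum2sq_sol (p a b : nat) : Prop :=
  [/\ (0 < a)%N, (0 < b)%N & (a ^ 2 + b ^ 2)%N = p].

(* Main.v *)
(* G is cyclic of order 4, so G = {1, -1, i, -i} with i^2 = -1, and Thue's
   pigeonhole applied to (x, y) |-> x + i y gives p = a^2 + b^2.  Hypersums of
   classes are sumsets, so k lies in the characteristic iff every class has k
   elements (with repetition) summing to 0.  A pair x, -x gives k = 2; a copies
   of x and b copies of j x with j = -a/b in G give k = a + b.  Conversely, for
   odd k, a zero sum of k elements of G reads X + i Y = 0 with |X| + |Y| <= k
   odd, so p divides X^2 + Y^2 > 0: either X^2 + Y^2 = p and
   {|X|, |Y|} = {a, b}, or (|X| + |Y|)^2 >= 2 p >= (a + b)^2. *)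
Require Import Defs.
From mathcomp Require Import all_boot all_order all_algebra all_fingroup.
From mathcomp Require Import cyclic.
From mathcomp Require Import finmap.
From mathcomp Require Import zify ring.

Set Implicit Arguments.
Unset Strict Implicit.
Unset Printing Implicit Defensive.

(** * Primes as sums of two squares: uniqueness and minimality *)

Lemma prime_nsquare p m : prime p -> m ^ 2 <> p.
Proof.
move=> p_pr mp; have pm : p %| m by have := Euclid_dvdX m 2 p_pr; rewrite mp dvdnn andbT.
have m0 : 0 < m by rewrite -sqrn_gt0 mp prime_gt0.
have := dvdn_leq m0 pm; have := prime_gt1 p_pr; nia.
Qed.

(** [p] divides [(a d)^2 - (b c)^2 = (a^2 - c^2) p], hence one of [a d - b c] and [a d + b c]. The
    difference is below [p], so it vanishes and [a = c]; a sum of at least [p] forces equality in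
    [2 a d <= a^2 + d^2] and [2 b c <= b^2 + c^2], whose right sides total [2 p]. *)
Lemma sum2sq_sol_uniq p a b c d : prime p ->
  sum2sq_sol p a b -> sum2sq_sol p c d -> (c = a /\ d = b) \/ (c = b /\ d = a).
Proof.
(* Exchanging the two solutions ensures that [a * d - b * c] is not truncated. *)
move=> p_pr; wlog le_bcad: a b c d / b * c <= a * d.
  move=> W ab cd; case/orP: (leq_total (b * c) (a * d)) => le; first exact: W.
  by have := @W c d a b; rewrite mulnC [c * b]mulnC => /(_ le cd ab); lia.
move=> [a0 b0 ab] [c0 d0 cd].
have key : (a * d) ^ 2 - (b * c) ^ 2 = (a ^ 2 - c ^ 2) * p.
  have: (a * d) ^ 2 + c ^ 2 * p = (b * c) ^ 2 + a ^ 2 * p.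
    by rewrite -{1}ab -cd; ring.
  by rewrite mulnBl; lia.
have: p %| (a * d - b * c) * (a * d + b * c) by rewrite -subn_sqr key dvdn_mull.
have amgm x y : 2 * (x * y) <= x ^ 2 + y ^ 2 by exact: nat_Cauchy.
rewrite Euclid_dvdM // => /orP[] pdvd.
  left; have adbc : a * d = b * c.
    have [|gt0] := posnP (a * d - b * c); first by lia.
    by have := dvdn_leq gt0 pdvd; have := amgm a d; nia.
  have ac : a = c.
    have: (a * d) ^ 2 + c ^ 2 * p = (b * c) ^ 2 + a ^ 2 * p.
      by rewrite -{1}ab -cd; ring.
    rewrite adbc => /addnI /eqP; rewrite eqn_pmul2r ?prime_gt0 // => /eqP.
    by move/sqrn_inj.
  by split=> //; apply: sqrn_inj; move: ab cd; rewrite ac; lia.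
right; have ple : p <= a * d + b * c by apply: dvdn_leq => //; nia.
have [e1 e2] := (amgm a d, amgm b c).
have /eqP : 2 * (a * d) == a ^ 2 + d ^ 2 by lia.
have /eqP : 2 * (b * c) == b ^ 2 + c ^ 2 by lia.
by split; nia.
Qed.

Lemma sum2sq_min_odd p a b x y : prime p -> sum2sq_sol p a b ->
  p %| x ^ 2 + y ^ 2 -> odd (x + y) -> a + b <= x + y.
Proof.
move=> p_pr ab /dvdnP[m em] oxy; case: (ab) => a0 b0 abp.
(* Cofactor 0 is excluded by parity, cofactor 1 falls to uniqueness once zero coordinates are ruled
   out, and a cofactor of at least 2 is large enough for a comparison of squares. *)
case: m em => [|[|m]] em.
- have [x0 y0] : x = 0 /\ y = 0 by nia.
  by move: oxy; rewrite x0 y0.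
- have [x0|x_gt0] := posnP x; first by case: (@prime_nsquare p y p_pr); lia.
  have [y0|y_gt0] := posnP y; first by case: (@prime_nsquare p x p_pr); lia.
  have xy : sum2sq_sol p x y by split=> //; lia.
  by case: (sum2sq_sol_uniq p_pr ab xy) => -[-> ->]; lia.
- have : (a + b) ^ 2 <= (x + y) ^ 2.
    have : 2 * (a * b) <= a ^ 2 + b ^ 2 by exact: nat_Cauchy.
    by rewrite !sqrnD; nia.
  by rewrite leq_sqr.
Qed.

Lemma sqrn_bounds n : exists s, s ^ 2 <= n < s.+1 ^ 2.
Proof.
elim: n => [|n [s /andP[le gt]]]; first by exists 0.
case: (ltnP n.+1 (s.+1 ^ 2)) => h; first by exists s; rewrite h; lia.
by exists s.+1; rewrite h /=; nia.
Qed.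

(** * Existence of a representation as a sum of two squares *)

Section Fp.
Import GRing.Theory.
Local Open Scope ring_scope.

Lemma natr_distn_sqr (R : comNzRingType) (m n : nat) :
  (`|m - n|%N)%:R ^+ 2 = (m%:R - n%:R) ^+ 2 :> R.
Proof.
case/orP: (leq_total m n) => le; last by rewrite distnEl // natrB.
by rewrite distnEr // natrB // -sqrrN opprB.
Qed.

Lemma sum2sq_exists p (i : 'F_p) : prime p -> i ^+ 2 = -1 ->
  exists a b, sum2sq_sol p a b.
Proof.
move=> p_pr i2; have [s /andP[sle sgt]] := sqrn_bounds p.
have slt : (s ^ 2 < p)%N.
  by rewrite ltn_neqAle sle andbT; apply/eqP; exact: prime_nsquare.
pose f (z : 'I_s.+1 * 'I_s.+1) : 'F_p := (z.1 : nat)%:R + i * (z.2 : nat)%:R.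
(* The box has [(s + 1)^2 > p] points, so two of them collide under [f]. *)
have /injectivePn[[x y] [[x' y'] neq]] : ~~ injectiveb f.
  apply/negP => /injectiveP /leq_card; rewrite card_prod !card_ord.
  by rewrite Fp_cast //; nia.
rewrite /f /= => fE.
have pdvd : (p %| `|x - x'| ^ 2 + `|y - y'| ^ 2)%N.
  rewrite (dvdn_pcharf (pchar_Fp p_pr)) natrD !natrX !natr_distn_sqr.
  have -> : (x%:R - x'%:R : 'F_p) = - (i * (y%:R - y'%:R)).
    have -> : (x%:R : 'F_p) = x'%:R + i * y'%:R - i * y%:R.
      by rewrite -fE addrK.
    by ring.
  by rewrite sqrrN exprMn i2 mulN1r addNr.
have gt0 : (0 < `|x - x'| ^ 2 + `|y - y'| ^ 2)%N.
  rewrite lt0n; apply: contra neq; move=> /eqP e.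
  have [e1 e2] : (x : nat) = x' /\ (y : nat) = y' by nia.
  by apply/eqP; congr pair; apply: val_inj.
have [Hx Hy Hx' Hy'] := And4 (ltn_ord x) (ltn_ord y) (ltn_ord x') (ltn_ord y').
have ub u v : (u < s.+1 -> v < s.+1 -> `|u - v| ^ 2 <= s ^ 2)%N.
  by move=> us vs; rewrite leq_sqr; lia.
(* This positive multiple of [p] is at most [2 s^2 < 2 p]. *)
have dE : (`|x - x'| ^ 2 + `|y - y'| ^ 2 = p)%N.
  have := ub _ _ Hx Hx'; have := ub _ _ Hy Hy'; move: pdvd gt0.
  set D := (_ ^ 2 + _ ^ 2)%N => pdvd gt0 Ey Ex.
  have Dle : (D <= 2 * s ^ 2)%N by rewrite /D; lia.
  case/dvdnP: pdvd gt0 Dle => m ->; rewrite muln_gt0 => /andP[m0 _] Dle.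
  have : (m * p < 2 * p)%N by lia.
  rewrite ltn_pmul2r ?prime_gt0 // => m2; have -> : m = 1%N by lia.
  by rewrite mul1n.
exists `|x - x'|%N, `|y - y'|%N; split=> //; rewrite lt0n; apply/eqP => d0.
  by move: dE; rewrite d0; apply: prime_nsquare.
by move: dE; rewrite d0 addn0; apply: prime_nsquare.
Qed.

(** * Hypersums as sums of orbit elements *)

Section Hyperfield.
Variables (p : nat) (G : {group {unit 'F_p}}).

Lemma hclassP (x y : 'F_p) :
  reflect (exists2 u : {unit 'F_p}, u \in G & y = x * val u) (y \in hclass G x).
Proof. by apply: (iffP orbitP) => -[u Gu e]; exists u => //; rewrite -e. Qed.

Lemma hclass_refl (x : 'F_p) : x \in hclass G x.
Proof. exact: orbit_refl. Qed.

(** A sumset of two orbits is stable under [G], so it contains an orbit as soon as it contains one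
    representative. *)
Lemma hclass_sub_sumset (x y z : 'F_p) :
  (hclass G z \subset [set s + t | s in hclass G x, t in hclass G y]) =
  (z \in [set s + t | s in hclass G x, t in hclass G y]).
Proof.
apply/subsetP/idP => [|/imset2P[s t /hclassP[u Gu ->] /hclassP[v Gv ->] ->] w].
  by apply; exact: hclass_refl.
case/hclassP=> k Gk ->; rewrite mulrDl -!mulrA.
by apply: imset2_f; apply/hclassP; [exists (u * k)%g|exists (v * k)%g];
  rewrite ?groupM.
Qed.

Lemma mem_hmuln k (x z : 'F_p) :
  hclass G z \in hmuln G k (hclass G x) <->
  exists2 s : seq 'F_p, size s = k /\ {subset s <= hclass G x} &
    z = \sum_(t <- s) t.
Proof.
elim: k z => [|k IH] z /=.
  rewrite inE; split=> [/eqP e|[s [/size0nil-> _] ->]]; last by rewrite big_nil.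
  exists [::] => //; rewrite big_nil.
  by have := hclass_refl z; rewrite e => /hclassP[u _ ->]; rewrite mul0r.
split.
  case/bigcupP=> _ /set1P-> /bigcupP[Y Yin]; rewrite inE => /andP[zH].
  (* Every member of an iterated hypersum is an orbit, so the induction hypothesis applies to a
     representative. *)
  have [w Yw] : exists w, Y = hclass G w.
    case: (k) Yin => [/set1P ->|m /bigcupP[? _ /bigcupP[? _]]]; first by exists 0.
    by rewrite inE => /andP[/imsetP[w _ ->] _]; exists w.
  rewrite Yw hclass_sub_sumset => /imset2P[t _ tx /hclassP[u Gu ->] ->].
  move: Yin; rewrite Yw => /IH[s [ss sx] ->].
  (* The factor [u] relating the tail to its representative is absorbed into each summand, which
     stays in the orbit of [x]. *)
  exists (t :: [seq r * val u | r <- s]).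
    split; first by rewrite /= size_map ss.
    move=> r; rewrite inE => /orP[/eqP->//|/mapP[q /sx /hclassP[v Gv ->] ->]].
    by apply/hclassP; exists (v * u)%g; rewrite ?groupM // mulrA.
  by rewrite big_cons big_map mulr_suml.
case=> -[|t s] [] // [ss] sx ->; rewrite big_cons.
apply/bigcupP; exists (hclass G x); first exact: set11.
apply/bigcupP; exists (hclass G (\sum_(r <- s) r)).
  by apply/IH; exists s => //; split=> // r rs; apply: sx; rewrite inE rs orbT.
rewrite inE hclass_sub_sumset; apply/andP; split; first exact: imset_f.
by apply: imset2_f; [apply: sx; rewrite mem_head | exact: hclass_refl].
Qed.

Lemma hcharP k : hchar G k <->
  forall x, exists2 s : seq 'F_p, size s = k /\ {subset s <= hclass G x} &
    \sum_(t <- s) t = 0.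
Proof.
split=> [H x | H _ /imsetP[x _ ->]].
  by have /mem_hmuln[s Hs e] := H (hclass G x) (imset_f _ isT); exists s.
by apply/mem_hmuln; have [s Hs e] := H x; exists s.
Qed.

(** * The characteristic when the group has order four *)

Hypotheses (p_pr : prime p) (cardG : #|G| = 4%N).

(** A generator [u] of the cyclic group [G] has [u^4 = 1], so [u^2] is 1 or -1, and 1 would
    contradict order 4. *)
Lemma card4_sqrtN1 : exists2 i : {unit 'F_p}, i \in G & val i ^+ 2 = -1.
Proof.
have /cyclicP[u Gu] := field_unit_group_cyclic G.
have ou : #[u]%g = 4%N by rewrite orderE -Gu.
exists u; first by rewrite Gu cycle_id.
have: (val u ^+ 2) ^+ 2 == 1 ^+ 2.
  by rewrite -exprM -[(2 * 2)%N]ou -FinRing.val_unitX expg_order expr1n.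
rewrite eqf_sqr => /orP[/eqP e|/eqP //].
have u2 : (u ^+ 2 = 1)%g by apply: val_inj; rewrite /= FinRing.val_unitX.
by have := order_dvdn u 2; rewrite ou u2 eqxx.
Qed.

(** In a field, -1 has no square roots besides [i] and [-i = i^3]. *)
Lemma sqrN1_inG (u : {unit 'F_p}) : val u ^+ 2 = -1 -> u \in G.
Proof.
move=> u2; have [i Gi i2] := card4_sqrtN1.
have: val u ^+ 2 == val i ^+ 2 by rewrite u2 i2.
rewrite eqf_sqr => /orP[] /eqP e; first by rewrite (val_inj e).
suff -> : u = (i ^+ 3)%g by rewrite groupX.
by apply: val_inj; rewrite e FinRing.val_unitX exprSr i2 mulN1r.
Qed.


(** Elements of [G] are roots of [X^4 - 1], hence among 1, -1, [i], [-i]; the four numbers count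
    their occurrences in [s]. *)
Lemma hclass1_sum (i : 'F_p) (s : seq 'F_p) : i ^+ 2 = -1 ->
  {subset s <= hclass G 1} ->
  exists m m' n n' : nat, (m + m' + (n + n') = size s)%N /\
    \sum_(t <- s) t = m%:R - m'%:R + i * (n%:R - n'%:R).
Proof.
move=> i2; elim: s => [|t s IH] sG /=.
  by exists 0, 0, 0, 0; rewrite big_nil !subrr mulr0 addr0.
have [|m [m' [n [n' [<- e]]]]] := IH.
  by move=> r rs; apply: sG; rewrite inE rs orbT.
rewrite big_cons e.
have /hclassP[u Gu te] := sG _ (mem_head t s); rewrite mul1r in te.
have : (t ^+ 2) ^+ 2 == 1 ^+ 2.
  rewrite te -exprM -FinRing.val_unitX -[(2 * 2)%N]cardG.
  by rewrite expg_cardG // expr1n.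
rewrite eqf_sqr -[-1]i2 -[X in (_ == X) || _](expr1n _ 2) !eqf_sqr.
case/orP=> /orP[] /eqP->.
- by exists m.+1, m', n, n'; split; [lia | rewrite !mulrSr; ring].
- by exists m, m'.+1, n, n'; split; [lia | rewrite !mulrSr; ring].
- by exists m, m', n.+1, n'; split; [lia | rewrite !mulrSr; ring].
- by exists m, m', n, n'.+1; split; [lia | rewrite !mulrSr; ring].
Qed.

Lemma hchar_lower k a b : sum2sq_sol p a b -> hchar G k -> odd k ->
  (a + b <= k)%N.
Proof.
move=> ab /hcharP /(_ 1)[s [<- sG] s0] os.
have [i _ i2] := card4_sqrtN1.
have [m [m' [n [n' [es]]]]] := hclass1_sum i2 sG.
rewrite s0 => /esym/eqP; rewrite addr_eq0 => /eqP e.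
(* Cancelling opposite terms preserves the parity of the length and does not increase it. *)
have : (a + b <= `|m - m'| + `|n - n'|)%N.
  apply: (@sum2sq_min_odd p) => //; last by move: os; rewrite -es; lia.
  rewrite (dvdn_pcharf (pchar_Fp p_pr)) natrD !natrX !natr_distn_sqr e.
  by rewrite sqrrN exprMn i2 mulN1r addNr.
by lia.
Qed.

Lemma hchar_upper k a b : odd p -> sum2sq_sol p a b ->
  ~~ odd k \/ (a + b <= k)%N -> hchar G k.
Proof.
move=> op [a0 b0 ab] hk; apply/hcharP => x.
have [i Gi i2] := card4_sqrtN1.
have xN : - x \in hclass G x.
  by apply/hclassP; exists (i ^+ 2)%g;
    rewrite ?groupX // FinRing.val_unitX i2 mulrN1.
have even_sum c : exists2 s : seq 'F_p,
    size s = c.*2 /\ {subset s <= hclass G x} & \sum_(t <- s) t = 0.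
  exists (nseq c x ++ nseq c (- x)).
    split; first by rewrite size_cat !size_nseq addnn.
    move=> t; rewrite mem_cat !mem_nseq.
    by case/orP=> /andP[_ /eqP->] //; exact: hclass_refl.
  by rewrite big_cat !big_nseq /= !iter_addr_0 mulNrn subrr.
have [ok|ek] := boolP (odd k); last first.
  by have := even_sum k./2; rewrite even_halfK.
case: hk => [/negP//|lek].
(* A number and its square have the same parity, so [a + b] is odd like [p]; hence [k - (a + b)] is
   even and can be filled with pairs [x], [-x]. *)
have oab : odd (a + b).
  by move: op; rewrite -ab !oddD !oddX /=; lia.
have bN0 : (b%:R : 'F_p) != 0.
  by rewrite -(dvdn_pcharf (pchar_Fp p_pr)) gtnNdvd //; nia.
have ab0 : (a%:R ^+ 2 + b%:R ^+ 2 : 'F_p) = 0.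
  by rewrite -!natrX -natrD ab pchar_Fp_0.
pose r : 'F_p := - (a%:R / b%:R).
have r2 : r ^+ 2 = -1.
  rewrite sqrrN exprMn exprVn; apply: (mulIf (expf_neq0 2 bN0)).
  by rewrite mulfVK ?expf_neq0 // mulN1r; apply/eqP; rewrite -addr_eq0 ab0.
have Ur : r \is a GRing.unit.
  by rewrite unitfE -sqrf_eq0 r2 oppr_eq0 oner_eq0.
pose j : {unit 'F_p} := FinRing.unit 'F_p Ur.
have Gj : j \in G by apply: sqrN1_inG.
have [s [ss sx] s0] := even_sum (k - (a + b))./2.
exists (nseq a x ++ nseq b (x * r) ++ s).
  split.
    rewrite !size_cat !size_nseq ss even_halfK ?oddB ?ok ?oab //.
    by rewrite addnA subnKC.
  move=> t; rewrite !mem_cat !mem_nseq => /or3P.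
  case=> [/andP[_ /eqP->]|/andP[_ /eqP->]|/sx//].
    exact: hclass_refl.
  by apply/hclassP; exists j.
rewrite !big_cat !big_nseq /= !iter_addr_0 s0 addr0 -[x *+ a]mulr_natr.
rewrite -[_ *+ b]mulr_natr -mulrA -mulrDr.
by rewrite /r mulNr divfK // subrr mulr0.
Qed.

End Hyperfield.
End Fp.

(** * Minimal generators of the monoid of even numbers and numbers at least [n] *)

Lemma gen2n_unique (M : nat -> Prop) n : odd n -> 2 < n ->
  (forall k, M k <-> ~~ odd k \/ n <= k) ->
  forall T : {fset nat}, min_generates M T <-> T = [fset 2; n]%fset.
Proof.
move=> on n_gt2 ME.
have sumE (c : nat -> nat) : \sum_(g <- [fset 2; n]%fset) g * c g = 2 * c 2 + n * c n.
  rewrite big_fsetU1 ?inE /=; last by lia.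
  by rewrite big_seq_fset1.
have gen2n : generates M [fset 2; n]%fset.
  move=> k; rewrite ME; split=> [hk|[c ->]]; last first.
    rewrite sumE; case: (c n) => [|m]; [left; lia | right; nia].
  have [ok|ek] := boolP (odd k).
    exists (fun g => if g == 2 then (k - n)./2 else 1).
    rewrite sumE eqxx; have -> : (n == 2) = false by lia.
    by case: hk; lia.
  exists (fun g => if g == 2 then k./2 else 0).
  by rewrite sumE eqxx; (have -> : (n == 2) = false by lia); lia.
(* Neither 2 nor [n] decomposes in the monoid, so both lie in every generating set; minimality and
   uniqueness of the pair then follow by cardinality. *)
have sub2n T : generates M T -> ([fset 2; n] `<=` T)%fset.
  move=> genT.
  have memM g : g \in T -> M g.
    move=> gT; apply/genT; exists (fun h => (h == g) : nat).
    rewrite (big_fsetD1 g) //= eqxx muln1 big_seq big1 ?addn0 // => h.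
    by rewrite !inE => /andP[/negbTE-> _]; rewrite muln0.
  have sum_ge (c : nat -> nat) g : g \in T ->
      g * c g <= \sum_(h <- T) h * c h.
    by move=> gT; rewrite (big_fsetD1 g) //= leq_addr.
  (* A sum outside an additive submonoid [P] has a term outside it; this is used for [P] the zero
     monoid and for [P] the even numbers. *)
  have sum0 (P : pred nat) (c : nat -> nat) :
      (forall m m', P m -> P m' -> P (m + m')) -> P 0 ->
      ~~ P (\sum_(h <- T) h * c h) -> exists2 g, g \in T & ~~ P (g * c g).
    move=> PD P0 nP; apply/hasP; apply: contraR nP => /hasPn H.
    rewrite big_seq; apply: (big_ind P) => // g gT.
    by have := H g gT; rewrite negbK.
  apply/fsubsetP => g; rewrite !inE => /orP[]/eqP->.
    have /genT[c e] : M 2 by apply/ME; left.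
    have [||h hT hc] := sum0 (pred1 0) c _ isT; [| by rewrite -e |].
      by move=> m m' /eqP-> /eqP->.
    have := sum_ge c h hT; rewrite -e => le2.
    (* The generator [h] of a nonzero term is 1 or 2, and 1 is not in [M] because [n > 2]. *)
    have [h0 c0] : 0 < h /\ 0 < c h by move: hc; rewrite /= muln_eq0; lia.
    have h2 : h <= 2 by nia.
    by have /ME hM := memM h hT; have <- : h = 2 by case: hM; lia.
  have /genT[c e] : M n by apply/ME; right.
  have [||h hT hc] := sum0 (fun m => ~~ odd m) c _ isT; [| by rewrite -e negbK |].
    by move=> m m'; rewrite oddD => /negbTE-> /negbTE->.
  (* An odd term has an odd generator [h], so [h >= n] by membership in [M], while the term is at
     most [n]. *)
  have := sum_ge c h hT; rewrite -e => len.
  move: hc; rewrite negbK oddM => /andP[oh oc].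
  have /ME[|nh] := memM h hT; first by rewrite oh.
  by have <- : h = n by have := leq_pmulr h (odd_gt0 oc); lia.
move=> T; split=> [[genT minT]|->].
  apply/esym/eqP; rewrite eqEfcard sub2n //=; exact: minT.
by split=> // S /sub2n /fsubset_leq_card.
Qed.

Theorem theorem9 (p : nat) (p_prime : prime p) (p_ge5 : 5 <= p)
    (G : {group {unit 'F_p}}) (cardG : #|G| = 4) :
  (exists a b : nat, sum2sq_sol p a b /\
     forall c d : nat, sum2sq_sol p c d ->
       (c = a /\ d = b) \/ (c = b /\ d = a)) /\
  (forall a b n : nat, sum2sq_sol p a b -> n = a + b ->
     gen_is G [fset 2; n]%fset).
Proof.
split=> [|a b n ab ->].
  have [i _ i2] := card4_sqrtN1 cardG.
  have [a [b ab]] := sum2sq_exists p_prime i2.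
  by exists a, b; split=> // c d; exact: sum2sq_sol_uniq.
have [a0 b0 abp] := ab.
have op : odd p by case/even_prime: p_prime p_ge5 => // ->.
apply: gen2n_unique.
- by move: op; rewrite -abp !oddD !oddX.
- by nia.
move=> k; split; last exact: hchar_upper.
by case: (boolP (odd k)) => [ok /(hchar_lower p_prime cardG ab)|]; auto.
Qed.
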